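(* For all $n\ge2$, the map $\psi$ restricts to a bijection between the set of connected nonnesting chord diagrams of size $n$ and the set of nonnesting chord diagrams of size $n-1$. (In particular, connected nonnesting diagrams lie in the domain of $\psi$.)
   Context: A chord diagram of size $n$ is a perfect matching of $\{1,\dots,2n\}$; chords are ordered pairs $(a,b)$ with $a<b$, $a$ the source and $b$ the sink. For chords $c_1=(a_1,b_1)$, $c_2=(a_2,b_2)$ with $a_1<a_2$: they cross if $a_2<b_1<b_2$, and then $c_2$ is a right neighbor of $c_1$; they form a nesting if $a_2<b_2<b_1$. A diagram is nonnesting if it contains no nesting. A diagram is connected if its intersection graph (chords as vertices, crossings as edges) is connected. A chord is terminal if it has no right neighbors. A diagram is 1-terminal if no chord other than the last one, in the order of sources, is terminal. The map $\psi$ from 1-terminal diagrams of size $n$ to diagrams of size $n-1$ ($n\ge 2$): let $T$ be 1-terminal with chords $c_1<\dots<c_n$ ordered by source. The source-sink group of a chord $c$ consists of the source of $c$ together with the maximal run of consecutive sinks immediately following it (excluding the sink of $c$ itself). Then $\psi(T)$ is obtained from $T$ by (1) moving each source to the end of its source-sink group (all other endpoints keeping their relative order and every source staying paired with its sink), and (2) deleting the terminal chord $c_n$; endpoints are then relabelled order-preservingly. *)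

(* Defs.v *)
(* Endpoints are labelled 0, ..., 2n-1 instead of 1, ..., 2n. *)
From mathcomp Require Import all_boot.
From mathcomp Require Import zify.

Set Implicit Arguments.
Unset Strict Implicit.
Unset Printing Implicit Defensive.

(* A chord (a, b) has source a and sink b; [is_diagram] enforces a < b. *)
Definition chord (n : nat) : Type := ('I_(2 * n) * 'I_(2 * n))%type.

Definition endpoint n (c : chord n) (x : 'I_(2 * n)) : bool :=
  (x == c.1) || (x == c.2).

Definition is_diagram n (D : {set chord n}) : bool :=
  [forall c in D, c.1 < c.2] && [forall x, #|[set c in D | endpoint c x]| == 1].

Definition diagram (n : nat) : Type := {D : {set chord n} | is_diagram D}.

Definition chords n (T : diagram n) : {set chord n} := val T.

Definition right_neighbor n (c1 c2 : chord n) : bool :=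
  [&& c1.1 < c2.1, c2.1 < c1.2 & c1.2 < c2.2].

Definition crossing n (c1 c2 : chord n) : bool :=
  right_neighbor c1 c2 || right_neighbor c2 c1.

Definition nested n (c1 c2 : chord n) : bool :=
  [&& c1.1 < c2.1, c2.1 < c2.2 & c2.2 < c1.2].

Definition nonnesting n (T : diagram n) : bool :=
  [forall c1 in chords T, forall c2 in chords T, ~~ nested c1 c2].

Definition intersection_graph n (T : diagram n) : rel (chord n) :=
  fun c1 c2 => [&& c1 \in chords T, c2 \in chords T & crossing c1 c2].

Definition connected n (T : diagram n) : bool :=
  [forall c1 in chords T, forall c2 in chords T,
     connect (intersection_graph T) c1 c2].

Definition terminal n (T : diagram n) (c : chord n) : bool :=
  [forall d in chords T, ~~ right_neighbor c d].

Definition is_last n (T : diagram n) (c : chord n) : bool :=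
  (c \in chords T) && [forall d in chords T, d.1 <= c.1].

Definition one_terminal n (T : diagram n) : bool :=
  [forall c in chords T, terminal T c ==> is_last T c].

Definition one_terminal_diagram (n : nat) : Type :=
  {T : diagram n | one_terminal T}.

Definition is_source n (T : diagram n) (x : 'I_(2 * n)) : bool :=
  [exists c in chords T, c.1 == x].

Definition is_sink n (T : diagram n) (x : 'I_(2 * n)) : bool :=
  [exists c in chords T, c.2 == x].

(* The group of the chord whose source is [a]. *)
Definition source_sink_group n (T : diagram n) (a : 'I_(2 * n)) :
    {set 'I_(2 * n)} :=
  a |: [set y : 'I_(2 * n) |
         [&& a < y, [forall z : 'I_(2 * n), (a < z <= y) ==> is_sink T z]
           & (a, y) \notin chords T]].

Definition group_end n (T : diagram n) (a : 'I_(2 * n)) : nat :=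
  \max_(y in source_sink_group T a) y.

(* Place of the endpoint [x] after step (1), in half-units: a sink stays at x,
   a source goes to group_end + 1/2, i.e. right after its whole group and
   before the next old position.  Only the order of these values matters. *)
Definition moved_place n (T : diagram n) (x : 'I_(2 * n)) : nat :=
  if is_source T x then (group_end T x).*2.+1 else (x : nat).*2.

(* The endpoints left after step (2). *)
Definition survives n (T : diagram n) (x : 'I_(2 * n)) : bool :=
  [exists c in chords T, ~~ is_last T c && endpoint c x].

(* Order-preserving relabelling of the surviving endpoints. *)
Definition new_label n (T : diagram n) (x : 'I_(2 * n)) : nat :=
  #|[set y | survives T y & moved_place T y < moved_place T x]|.

Definition psi_chords n (T : diagram n) : {set chord n.-1} :=
  [set d : chord n.-1 | [exists c in chords T,
     [&& ~~ is_last T c, d.1 == new_label T c.1 :> nat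
       & d.2 == new_label T c.2 :> nat]]].

Section PsiDiagram.
Variables (n : nat) (T : diagram n).

Lemma chord_lt c : c \in chords T -> c.1 < c.2.
Proof. by case/andP: (valP T) => /forall_inP h _ /h. Qed.

Lemma chord_ex x : exists2 c, c \in chords T & endpoint c x.
Proof.
case/andP: (valP T) => _ /forallP /(_ x) /cards1P [c hc].
by have := set11 c; rewrite -hc inE => /andP [? ?]; exists c.
Qed.

Lemma chord_uniq x c d : c \in chords T -> d \in chords T ->
  endpoint c x -> endpoint d x -> c = d.
Proof.
case/andP: (valP T) => _ /forallP /(_ x) /cards1P [e he] hc hd cx dx.
have: c \in [set e] by rewrite -he inE cx andbT.
have: d \in [set e] by rewrite -he inE dx andbT.
by rewrite !inE => /eqP -> /eqP ->.
Qed.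

Lemma endpoint1 (c : chord n) : endpoint c c.1.
Proof. by rewrite /endpoint eqxx. Qed.
Lemma endpoint2 (c : chord n) : endpoint c c.2.
Proof. by rewrite /endpoint eqxx orbT. Qed.

Lemma source_not_sink x : is_source T x -> ~~ is_sink T x.
Proof.
case/exists_inP => c hc /eqP <-; apply/exists_inP => -[d hd /eqP e].
have ed : endpoint d c.1 by rewrite -e endpoint2.
have ecd := chord_uniq hc hd (endpoint1 c) ed.
by have := chord_lt hd; rewrite e ecd ltnn.
Qed.

Lemma source1 c : c \in chords T -> is_source T c.1.
Proof. by move=> hc; apply/exists_inP; exists c. Qed.

Lemma sink2 c : c \in chords T -> is_source T c.2 = false.
Proof.
move=> hc; apply: contraTF isT => /source_not_sink /negP [].
by apply/exists_inP; exists c.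
Qed.

Lemma group_end_lt (a a' : 'I_(2 * n)) : is_source T a' -> a < a' -> group_end T a < a'.
Proof.
move=> sa' laa'; have a'0 : 0 < (a' : nat) by apply: leq_ltn_trans laa'.
rewrite -(prednK a'0) ltnS; apply/bigmax_leqP => y.
rewrite !inE => /orP [/eqP -> | /and3P [ay /forallP h _]]; first by lia.
have := h a'; rewrite laa' (negbTE (source_not_sink sa')) implybF /=.
by lia.
Qed.

Lemma group_end_ge (a : 'I_(2 * n)) : a <= group_end T a.
Proof. by apply: (@leq_bigmax_cond _ _ (fun y : 'I__ => y : nat)); rewrite !inE eqxx. Qed.

Lemma moved_place_inj : injective (moved_place T).
Proof.
move=> x y; rewrite /moved_place; case: ifP => sx; case: ifP => sy e; try lia.
- have {}e : group_end T x = group_end T y by lia.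
  case: (ltngtP x y) => [l|l|/val_inj //].
  + by have := group_end_lt sy l; have := group_end_ge y; lia.
  + by have := group_end_lt sx l; have := group_end_ge x; lia.
- by apply: val_inj => /=; lia.
Qed.

Lemma last_ex : 0 < n -> exists c, is_last T c.
Proof.
move=> n0; have x0 : 'I_(2 * n) by apply: (@Ordinal _ 0); lia.
have [c hc _] := chord_ex x0.
case: (arg_maxnP (fun c : chord n => c.1 : nat) hc) => d hd h.
by exists d; apply/andP; split => //; apply/forall_inP => e /h.
Qed.

Lemma last_uniq c d : is_last T c -> is_last T d -> c = d.
Proof.
case/andP => hc /forall_inP mc /andP [hd /forall_inP md].
have e : c.1 = d.1 by apply: val_inj; apply/eqP; rewrite eqn_leq mc // md.
by apply: (chord_uniq hc hd (endpoint1 c)); rewrite e endpoint1.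
Qed.

Lemma survivesP c x : c \in chords T -> endpoint c x ->
  survives T x = ~~ is_last T c.
Proof.
move=> hc cx; apply/exists_inP/idP => [[d hd /andP [nd dx]]|nc].
  by rewrite (chord_uniq hc hd cx dx).
by exists c => //; rewrite nc.
Qed.

Lemma card_survives : #|[set x | survives T x]| = 2 * n.-1.
Proof.
case: (posnP n) => [n0|n0].
  have -> : [set x | survives T x] = set0.
    by apply/setP => x; have := ltn_ord x; rewrite [in X in _ < X]n0.
  by rewrite cards0 n0.
have [c hc] := last_ex n0; have cT : c \in chords T by case/andP: hc.
have -> : [set x | survives T x] = ~: [set c.1; c.2].
  apply/setP => x; rewrite !inE; have [d hd dx] := chord_ex x.
  rewrite (survivesP hd dx); congr (~~ _).
  apply/idP/idP => [ld|cx]; first by rewrite (last_uniq hc ld).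
  by rewrite (chord_uniq hd cT dx cx).
have := cardsC [set c.1; c.2]; rewrite cards2 card_ord.
have -> : c.1 != c.2 by apply/eqP => e; have := chord_lt cT; rewrite e ltnn.
lia.
Qed.

Lemma new_label_mono x y : survives T x ->
  moved_place T x < moved_place T y -> new_label T x < new_label T y.
Proof.
move=> sx lxy; apply: proper_card; apply/properP; split.
  by apply/subsetP => z; rewrite !inE => /andP [-> /ltn_trans]; apply.
by exists x; rewrite !inE ?sx ?ltnn.
Qed.

Lemma new_label_inj x y : survives T x -> survives T y ->
  new_label T x = new_label T y -> x = y.
Proof.
move=> sx sy e; case: (ltngtP (moved_place T x) (moved_place T y)) => [l|l|].
- by have := new_label_mono sx l; rewrite e ltnn.
- by have := new_label_mono sy l; rewrite e ltnn.
- exact: moved_place_inj.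
Qed.

Lemma new_label_lt x : survives T x -> new_label T x < 2 * n.-1.
Proof.
move=> sx; rewrite -card_survives; apply: proper_card; apply/properP; split.
  by apply/subsetP => z; rewrite !inE => /andP [].
by exists x; rewrite !inE ?sx ?ltnn.
Qed.

Lemma new_label_surj (p : 'I_(2 * n.-1)) :
  exists2 x, survives T x & new_label T x = p.
Proof.
pose f x := odflt p (insub (new_label T x)).
have fE x : survives T x -> f x = new_label T x :> nat.
  by move=> sx; rewrite /f (insubT (fun k => k < _) (new_label_lt sx)).
have : f @: [set x | survives T x] = setT.
  apply/eqP; rewrite eqEcard subsetT cardsT card_ord card_in_imset.
    by rewrite card_survives leqnn.
  move=> x y; rewrite !inE => sx sy e.
  by apply: new_label_inj => //; rewrite -!fE // e.
move/setP/(_ p); rewrite inE => /imsetP [x]; rewrite inE => sx ->.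
by exists x => //; rewrite fE.
Qed.

End PsiDiagram.

Lemma psi_chords_diagram n (T : diagram n) :
  one_terminal T -> is_diagram (psi_chords T).
Proof.
move=> /forall_inP oT; apply/andP; split.
  apply/forall_inP => d; rewrite inE => /exists_inP [c hc].
  case/and3P => nc /eqP -> /eqP ->.
  apply: new_label_mono; first by rewrite (survivesP hc (endpoint1 c)).
  rewrite /moved_place (source1 hc) (sink2 hc).
  have: ~~ terminal T c by apply: contra nc; exact/implyP/oT.
  case/forall_inPn => d' hd'; rewrite negbK => /and3P [l1 l2 _].
  by rewrite ltn_Sdouble (ltn_trans (group_end_lt (source1 hd') l1) l2).
apply/forallP => p; have [x sx ex] := new_label_surj T p.
have [c hc cx] := chord_ex T x; have nc := sx; rewrite (survivesP hc cx) in nc.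
have s1 : survives T c.1 by rewrite (survivesP hc (endpoint1 c)).
have s2 : survives T c.2 by rewrite (survivesP hc (endpoint2 c)).
apply/cards1P.
exists (Ordinal (new_label_lt s1), Ordinal (new_label_lt s2)).
apply/setP => d; rewrite !inE; apply/andP/eqP => [[/exists_inP [c' hc']]|->].
  case/and3P => nc' /eqP e1 /eqP e2 dp.
  have c'x : endpoint c' x.
    case/orP: dp => /eqP ep; rewrite ep ?e1 ?e2 in ex.
      rewrite (new_label_inj sx _ ex) ?endpoint1 //.
      by rewrite (survivesP hc' (endpoint1 c')).
    rewrite (new_label_inj sx _ ex) ?endpoint2 //.
    by rewrite (survivesP hc' (endpoint2 c')).
  have ec := chord_uniq hc hc' cx c'x; rewrite -ec in e1 e2.
  by case: d e1 e2 {dp} => d1 d2 /= e1 e2; congr (_, _); apply: val_inj.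
split; first by apply/exists_inP; exists c => //=; rewrite nc !eqxx.
by case/orP: cx => /eqP e; rewrite /endpoint -!val_eqE /= -ex e eqxx ?orbT.
Qed.

Definition psi n (T : one_terminal_diagram n) : diagram n.-1 :=
  exist _ (psi_chords (val T)) (psi_chords_diagram (valP T)).

(* Main.v *)
Require Import Defs.
From mathcomp Require Import all_boot.
From mathcomp Require Import zify.

(* A nonnesting diagram is determined by its set of sources, because the k-th
   source is matched with the k-th sink.  In a 1-terminal diagram the group of
   every chord but the last one stops just before the next source, so psi gives
   this chord the label of the next source minus 1, and every surviving sink its
   own label minus 1: on words of sources and sinks, psi deletes the first and
   the last letter.  Injectivity follows.  For surjectivity, the preimage of D
   matches each shifted sink with the shifted source preceding its own source in
   D (or with the new source 0), and the last shifted source with the new last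
   sink; being nonnesting with the right sources, it is mapped to D. *)

Set Implicit Arguments.
Unset Strict Implicit.
Unset Printing Implicit Defensive.

(* [lia] compares atoms syntactically: [simpl] unfolds the canonical structures
   hidden in the types of the projections [c.1] and [c.2]. *)
Ltac ord_lia := simpl in *; lia.

(** Injectivity and the bound make [g] a bijection from [A] onto the integers below [#|A|], so every
    value below [g y] is attained exactly once. This turns the counting definition of [new_label]
    into a closed formula. *)
Lemma card_rank (I : finType) (A : {set I}) (g : I -> nat) (y : I) :
  {in A &, injective g} -> {in A, forall x, g x < #|A|} -> y \in A ->
  #|[set x in A | g x < g y]| = g y.
Proof.
move=> gI gB yA; have A0 := leq_ltn_trans (leq0n _) (gB y yA).
have kP x : x \in A -> g x %% #|A| = g x by move=> /gB /modn_small.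
pose k x : 'I_#|A| := Ordinal (ltn_pmod (g x) A0).
have kI : {in A &, injective k}.
  by move=> x z xA zA [] /eqP; rewrite !kP // => /eqP; apply: gI.
have kS : k @: A = setT.
  by apply/eqP; rewrite eqEcard subsetT cardsT card_ord card_in_imset /=.
have -> : #|[set x in A | g x < g y]| = #|k @: [set x in A | g x < g y]|.
  rewrite card_in_imset // => x z; rewrite !inE => /andP [xA _] /andP [zA _].
  exact: kI.
have -> : k @: [set x in A | g x < g y] = [set i : 'I_#|A| | i < g y].
  apply/setP => i; rewrite inE; apply/imsetP/idP => [[x]|ilt].
    by rewrite inE => /andP [xA lt] ->; rewrite /= kP.
  have /imsetP [x xA ix] : i \in k @: A by rewrite kS inE.
  by exists x => //; rewrite inE xA -(kP x xA) -[_ %% _]/(val (k x)) -ix.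
have le : g y <= #|A| by exact/ltnW/gB.
have -> : [set i : 'I_#|A| | i < g y] = widen_ord le @: setT.
  apply/setP => i; rewrite inE; apply/idP/imsetP => [lt|[j _ ->]].
    by exists (Ordinal lt) => //; apply: val_inj.
  by rewrite /= ltn_ord.
by rewrite card_imset ?cardsT ?card_ord // => i j /(congr1 val) /= /val_inj.
Qed.

Lemma source_or_sink n (T : diagram n) x : is_sink T x = ~~ is_source T x.
Proof.
apply/idP/idP => [sx|nx]; first by apply: contraL sx; apply: source_not_sink.
have [c hc /orP [] /eqP e] := chord_ex T x.
  by rewrite e source1 in nx.
by apply/exists_inP; exists c; rewrite ?e.
Qed.

Lemma one_terminalP n (T : diagram n) (c : chord n) :
  one_terminal T -> c \in chords T -> ~~ is_last T c ->
  exists2 d : chord n, d \in chords T & right_neighbor c d.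
Proof.
move=> /forall_inP oT hc nc.
have /forall_inPn [d hd] : ~~ terminal T c by apply: contra nc; apply/implyP/oT.
by rewrite negbK => rn; exists d.
Qed.

(** * Nonnesting diagrams: order of sinks, connectedness, determination by sources *)

Section Nonnesting.
Variables (n : nat) (T : diagram n).
Hypothesis nT : nonnesting T.

Lemma nonnesting_source_lt c d : c \in chords T -> d \in chords T ->
  c.1 < d.1 -> c.2 < d.2.
Proof.
move=> hc hd lt; have /forall_inP /(_ _ hc) /forall_inP /(_ _ hd) := nT.
rewrite /nested lt (chord_lt hd) /= -leqNgt leq_eqVlt => /orP [/eqP /val_inj e|//].
have ecd : c = d.
  by apply: (chord_uniq hc hd (endpoint2 c)); rewrite e endpoint2.
by rewrite ecd ltnn in lt.
Qed.

Lemma nonnesting_lt c d : c \in chords T -> d \in chords T ->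
  (c.1 < d.1) = (c.2 < d.2).
Proof.
move=> hc hd; apply/idP/idP; first exact: nonnesting_source_lt.
move=> lt; case: (ltngtP c.1 d.1) => // [gt|/val_inj e].
  by have := nonnesting_source_lt hd hc gt; ord_lia.
have ecd : c = d.
  by apply: (chord_uniq hc hd (endpoint1 c)); rewrite e endpoint1.
by rewrite ecd ltnn in lt.
Qed.

(** Both sides count the chords preceding [c], once through their sources and once through their
    sinks; by [nonnesting_lt] the two orders agree. *)
Lemma nonnesting_count c : c \in chords T ->
  #|[set x | is_source T x & x < c.1]| = #|[set x | is_sink T x & x < c.2]|.
Proof.
move=> hc.
have -> : [set x | is_source T x & x < c.1]
          = fst @: [set d in chords T | d.1 < c.1].
  apply/setP => x; rewrite inE; apply/andP/imsetP.
    by case=> /exists_inP [d hd /eqP <-] lt; exists d; rewrite // inE hd.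
  by case=> d; rewrite inE => /andP [hd lt] ->; rewrite source1.
have -> : [set x | is_sink T x & x < c.2]
          = snd @: [set d in chords T | d.1 < c.1].
  apply/setP => x; rewrite inE; apply/andP/imsetP.
    case=> /exists_inP [d hd /eqP <-] lt; exists d => //.
    by rewrite inE hd nonnesting_lt.
  case=> d; rewrite inE => /andP [hd lt] ->; rewrite -nonnesting_lt //.
  by split=> //; apply/exists_inP; exists d.
rewrite !card_in_imset // => d e; rewrite !inE => /andP [hd _] /andP [he _] eq.
  by apply: (chord_uniq hd he (endpoint2 d)); rewrite eq endpoint2.
by apply: (chord_uniq hd he (endpoint1 d)); rewrite eq endpoint1.
Qed.

(** If a terminal [c] is not last, no crossing leaves the set of chords with source at most [c.1]: a
    chord [e] inside crossing an [f] outside would give [f.1 < e.2 <= c.2 < f.2], making [f] a right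
    neighbor of [c]. Connectedness forbids such a proper closed set. *)
Lemma connected_one_terminal : connected T -> one_terminal T.
Proof.
move=> /forall_inP cT; apply/forall_inP => c hc; apply/implyP => /forall_inP tc.
apply: contraT; rewrite negb_and hc /= => /forall_inPn [d hd]; rewrite -ltnNge => lt.
have clos : closed (intersection_graph T) [pred e : chord n | e.1 <= c.1].
  have half e f : e \in chords T -> f \in chords T -> crossing e f ->
    e.1 <= c.1 -> f.1 <= c.1.
    move=> he hf cr lec; rewrite leqNgt; apply/negP => ltf.
    have lefc : e.2 <= c.2 by rewrite leqNgt -nonnesting_lt // -leqNgt.
    have ltcf := nonnesting_source_lt hc hf ltf.
    case/orP: cr => /and3P [l1 l2 _]; last first.
      by have := ltn_trans ltf (leq_trans l1 lec); rewrite ltnn.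
    by have := tc _ hf; rewrite /right_neighbor ltf ltcf (leq_trans l2 lefc).
  move=> e f /and3P [he hf cr]; rewrite !inE; apply/idP/idP; apply: half => //.
  by rewrite /crossing orbC.
have := closed_connect clos (forall_inP (cT c hc) d hd).
by rewrite !inE leqnn (leqNgt d.1) lt.
Qed.

Lemma one_terminal_connected : one_terminal T -> connected T.
Proof.
move=> oT.
have sym : connect_sym (intersection_graph T).
  apply: sym_connect_sym => c d; rewrite /intersection_graph /crossing orbC.
  by rewrite andbCA.
case: (posnP n) => [n0|n0].
  by apply/forall_inP => c; have := ltn_ord c.1; rewrite [in X in _ < X]n0.
have [l ll] := last_ex T n0.
(* Passing to a right neighbor increases the source, so the walk stops, and it can only stop at the
   last chord. *)
have toL c : c \in chords T -> connect (intersection_graph T) c l.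
  have [k] := ubnP (2 * n - c.1); elim: k c => // k IH c lek hc.
  case: (boolP (is_last T c)) => [lc|nc]; first by rewrite (last_uniq lc ll).
  have [d hd rn] := one_terminalP oT hc nc.
  apply: (@connect_trans _ _ d).
    by apply: connect1; rewrite /intersection_graph hc hd /crossing rn.
  apply: IH => //; case/andP: rn => lt _; have := ltn_ord d.1; ord_lia.
apply/forall_inP => c hc; apply/forall_inP => d hd.
by apply: connect_trans (toL c hc) _; rewrite sym; apply: toL.
Qed.

End Nonnesting.

Lemma nonnesting_source_inj n (T T' : diagram n) :
  nonnesting T -> nonnesting T' -> is_source T =1 is_source T' -> T = T'.
Proof.
have half (U U' : diagram n) : nonnesting U -> nonnesting U' ->
  is_source U =1 is_source U' -> chords U \subset chords U'.
  move=> nU nU' eqs; apply/subsetP => c hc.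
  have eqk : is_sink U =1 is_sink U' by move=> x; rewrite !source_or_sink eqs.
  have /exists_inP [d hd /eqP ed] : is_source U' c.1 by rewrite -eqs source1.
  (* Chords with a common source have sinks of equal rank; the rank is strictly increasing on sinks,
     so the sinks coincide. *)
  have E : #|[set x | is_sink U x & x < c.2]| = #|[set x | is_sink U x & x < d.2]|.
    transitivity #|[set x | is_source U' x & x < d.1]|.
      by rewrite -nonnesting_count // ed; apply: eq_card => x; rewrite !inE eqs.
    by rewrite nonnesting_count //; apply: eq_card => x; rewrite !inE eqk.
  have mono (x y : 'I_(2 * n)) : is_sink U x -> x < y ->
    #|[set z | is_sink U z & z < x]| < #|[set z | is_sink U z & z < y]|.
    move=> sx lt; apply: proper_card; apply/properP; split.
      by apply/subsetP => z; rewrite !inE => /andP [-> /ltn_trans]; apply.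
    by exists x; rewrite !inE ?sx ?ltnn.
  have sc : is_sink U c.2 by apply/exists_inP; exists c.
  have sd : is_sink U d.2 by rewrite eqk; apply/exists_inP; exists d.
  suff -> : c = d by [].
  case: (ltngtP c.2 d.2) => [/(mono _ _ sc)|/(mono _ _ sd)|/val_inj e2].
  - by rewrite E ltnn.
  - by rewrite E ltnn.
  by case: c d ed e2 {hc hd E sc sd} => ? ? [? ?] /= -> ->.
move=> nT nT' e; apply: val_inj; apply/eqP; rewrite eqEsubset.
by apply/andP; split; apply: half.
Qed.

(** Moving sources to the ends of their groups changes neither the order among sources nor the order
    among sinks, and a nesting depends only on these two orders. *)
Lemma psi_nonnesting n (T : one_terminal_diagram n) :
  nonnesting (val T) -> nonnesting (psi T).
Proof.
case: T => T oT /= nT; apply/forall_inP => d1; rewrite inE.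
case/exists_inP => c1 h1 /and3P [l1 /eqP e11 /eqP e12].
apply/forall_inP => d2; rewrite inE.
case/exists_inP => c2 h2 /and3P [l2 /eqP e21 /eqP e22].
have nle x y : survives T y -> new_label T x < new_label T y ->
    moved_place T x < moved_place T y.
  move=> sy; apply: contraTT; rewrite -!leqNgt leq_eqVlt.
  case/orP => [/eqP /moved_place_inj -> //|/(new_label_mono sy)]; exact: ltnW.
apply/negP; rewrite /nested e11 e21 e12 e22 => /and3P [lt _ gt].
move: (nle _ _ (etrans (survivesP h2 (endpoint1 _)) l2) lt).
move: (nle _ _ (etrans (survivesP h1 (endpoint2 _)) l1) gt).
rewrite /moved_place !sink2 // !source1 // ltn_double => {}gt {}lt.
case: (ltngtP c1.1 c2.1) => [lt1|gt1|e].
- by have := nonnesting_source_lt nT h1 h2 lt1; ord_lia.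
- have := group_end_lt (source1 h1) gt1; have := group_end_ge T c1.1; ord_lia.
- by move: lt; rewrite (val_inj e) ltnn.
Qed.

(** * Labels in 1-terminal diagrams: [psi] as deletion of the first and last letters *)

Section OneTerminal.
Variables (n : nat) (T : diagram n).
Hypothesis oT : one_terminal T.

(** The witness is the first source [w] after [c.1]: only sinks lie in between. The right neighbor
    [d] gives [w <= d.1 < c.2], so the sink of [c], which the group excludes, does not cut the run
    short. *)
Lemma group_end_next c : c \in chords T -> ~~ is_last T c ->
  exists2 w : 'I_(2 * n), is_source T w & w = (group_end T c.1).+1 :> nat.
Proof.
move=> hc nc; have [d hd /and3P [lt1 lt2 _]] := one_terminalP oT hc nc.
pose P x := is_source T x && (c.1 < x).
have P0 : P d.1 by rewrite /P source1.
case: (arg_minnP (fun x : 'I_(2 * n) => x : nat) P0) => w /andP [sw ltw] wmin.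
exists w => //; have lew := wmin _ P0.
have w0 : w.-1 < 2 * n by have := ltn_ord w; ord_lia.
have := group_end_lt sw ltw; suff : w.-1 <= group_end T c.1 by ord_lia.
apply: (@leq_bigmax_cond _ _ (fun y : 'I__ => y : nat) (Ordinal w0)).
rewrite !inE -val_eqE /=; case: (ltngtP c.1 w.-1) => [lt /=||//]; last by ord_lia.
apply/andP; split.
  apply/forallP => z; apply/implyP => lz; rewrite source_or_sink; apply/negP => sz.
  by have := wmin z; rewrite /P sz; ord_lia.
apply/negP => h; have e := chord_uniq hc h (endpoint1 c) (endpoint1 (_, _)).
by move: lt2; rewrite e /=; ord_lia.
Qed.

Lemma new_labelE x : survives T x -> new_label T x = (moved_place T x).-1./2.
Proof.
pose S := [set y | survives T y]; pose g y := (moved_place T y).-1./2.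
(* Undoing the half-units, [g y] is the group end of a source and the position minus 1 of a sink. *)
have gP y : y \in S -> if is_source T y
    then exists2 w : 'I_(2 * n), is_source T w & w = (g y).+1 :> nat
    else y = (g y).+1 :> nat.
  rewrite inE => sy; have [c hc cy] := chord_ex T y.
  rewrite (survivesP hc cy) in sy.
  case: ifP => ys; rewrite /g /moved_place ys.
    case/orP: cy => /eqP e; last by rewrite e sink2 in ys.
    by rewrite /= doubleK e; apply: group_end_next.
  case/orP: cy => /eqP e; first by rewrite e source1 in ys.
  have := chord_lt hc; rewrite -e; ord_lia.
have gI : {in S &, injective g}.
  move=> y z yS zS e; move: (gP y yS) (gP z zS) (e).
  case: ifP => sy; case: ifP => sz.
  - move=> _ _; rewrite /g /moved_place sy sz /= !doubleK => e'.
    by apply: (@moved_place_inj _ T); rewrite /moved_place sy sz e'.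
  - case=> w sw ew ez _; have ewz : w = z by apply: val_inj; rewrite /= ew ez e.
    by rewrite -ewz sw in sz.
  - move=> ey [w sw ew] _; have ewy : w = y by apply: val_inj; rewrite /= ew ey e.
    by rewrite -ewy sw in sy.
  - by move=> ey ez _; apply: val_inj; rewrite /= ey ez e.
(* In both cases some sink lies strictly after position [(g y).+1], hence [(g y).+1] is at most
   [2 * n - 2]. *)
have gB : {in S, forall y, g y < #|S|}.
  move=> y yS; rewrite card_survives; move: (gP y yS); case: ifP => _.
    case=> w /exists_inP [c hc /eqP e] ew.
    have := chord_lt hc; have := ltn_ord c.2; rewrite e ew; ord_lia.
  move=> ey; rewrite inE in yS; have [c hc cy] := chord_ex T y.
  rewrite (survivesP hc cy) in yS.
  have [d hd /and3P [lt1 lt2 lt3]] := one_terminalP oT hc yS.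
  by have := ltn_ord d.2; case/orP: cy => /eqP ey'; move: ey; rewrite ey'; ord_lia.
move=> sx; have xS : x \in S by rewrite inE.
rewrite -/(g x) -(card_rank gI gB xS); apply: eq_card => y; rewrite !inE.
case sy: (survives T y) => //=; have yS : y \in S by rewrite inE.
apply/idP/idP => [lt|]; last by rewrite /g; ord_lia.
(* Halving only preserves the weak inequality; injectivity of [g] on [S] makes it strict. *)
rewrite ltn_neqAle; apply/andP; split; last by rewrite /g; ord_lia.
by apply/eqP => /(gI _ _ yS xS) e; rewrite e ltnn in lt.
Qed.

End OneTerminal.

(** A source labelled [x] comes from a group ending at [x], so the next source of [T] sits at
    [x.+1]; a sink labelled [x] was itself at [x.+1]. *)
Lemma psi_source n (T : one_terminal_diagram n) (x : 'I_(2 * n.-1)) (y : 'I_(2 * n)) :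
  y = x.+1 :> nat -> is_source (psi T) x = is_source (val T) y.
Proof.
case: T => T oT /= yx; have [d hd dx] := chord_ex (psi (exist _ T oT)) x.
have := hd; rewrite inE => /exists_inP [c hc /and3P [nc /eqP e1 /eqP e2]].
case/orP: dx => /eqP e; rewrite e.
  rewrite source1 //; apply/esym.
  have [w sw ew] := group_end_next oT hc nc.
  suff -> : y = w by [].
  apply: val_inj; rewrite /= yx e e1 ew new_labelE //.
    by rewrite /moved_place source1 //= doubleK.
  by rewrite (survivesP hc (endpoint1 c)).
rewrite sink2 //; apply/esym.
suff -> : y = c.2 by rewrite sink2.
apply: val_inj; rewrite /= yx e e2 new_labelE //.
  by rewrite /moved_place sink2 //; have := chord_lt hc; ord_lia.
by rewrite (survivesP hc (endpoint2 c)).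
Qed.

(** * Construction of the preimage *)

Section Lift.
Variables (m : nat) (D : diagram m).
Hypothesis nD : nonnesting D.

(* The sentinel [(2m, 2m)] is the one that lifts to the new terminal chord. *)
Definition sentinel_chord (a b : nat) : bool :=
  [exists c in chords D, (c.1 == a :> nat) && (c.2 == b :> nat)]
  || (a == 2 * m) && (b == 2 * m).

(* The empty maximum 0 is the new first source. *)
Definition prev_source (a : nat) : nat :=
  \max_(y : 'I_(2 * m) | is_source D y && (y < a)) y.+1.

(** The indices range over ['I_(2 * m).+1] to make room for the sentinel value [2 * m]. *)
Definition lift_chords : {set chord m.+1} :=
  [set c : chord m.+1 | [exists a : 'I_(2 * m).+1, exists b : 'I_(2 * m).+1,
     [&& sentinel_chord a b, c.1 == prev_source a :> nat
       & c.2 == b.+1 :> nat]]].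

Lemma sentinel_chordP a b : sentinel_chord a b ->
  (exists c : chord m, [/\ c \in chords D, a = c.1 & b = c.2])
  \/ a = 2 * m /\ b = 2 * m.
Proof.
case/orP => [/exists_inP [c hc /andP [/eqP <- /eqP <-]]|/andP [/eqP -> /eqP ->]].
  by left; exists c.
by right.
Qed.

Lemma sentinel_chord_le a b : sentinel_chord a b -> a <= b <= 2 * m.
Proof.
case/sentinel_chordP => [[c [hc -> ->]]|[-> ->]]; last by rewrite leqnn.
by have := chord_lt hc; have := ltn_ord c.2; ord_lia.
Qed.

Lemma sentinel_chord_lt a b a' b' : sentinel_chord a b -> sentinel_chord a' b' ->
  (a < a') = (b < b').
Proof.
case/sentinel_chordP => [[c [hc -> ->]]|[-> ->]];
  case/sentinel_chordP => [[d [hd -> ->]]|[-> ->]].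
- by rewrite (nonnesting_lt nD hc hd).
- by have := ltn_ord c.1; have := ltn_ord c.2; ord_lia.
- by have := ltn_ord d.1; have := ltn_ord d.2; ord_lia.
- by rewrite !ltnn.
Qed.

Lemma lift_chordsP (c : chord m.+1) : reflect
  (exists a b, [/\ sentinel_chord a b, c.1 = prev_source a :> nat
                 & c.2 = b.+1 :> nat])
  (c \in lift_chords).
Proof.
rewrite inE; apply: (iffP existsP).
  by case=> a /existsP [b /and3P [? /eqP ? /eqP ?]]; exists a, b.
case=> a [b [sab e1 e2]]; have /andP [lab lb] := sentinel_chord_le sab.
have la : a < (2 * m).+1 by rewrite ltnS (leq_trans lab).
exists (Ordinal la); apply/existsP; exists (Ordinal (lb : b < (2 * m).+1)).
by rewrite /= sab e1 e2 !eqxx.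
Qed.

Lemma prev_source_le a : prev_source a <= a.
Proof. by apply/bigmax_leqP => y /andP []. Qed.

Lemma prev_source_gt (y : 'I_(2 * m)) a :
  is_source D y -> y < a -> y < prev_source a.
Proof.
move=> sy lt.
by apply: (@leq_bigmax_cond _ _ (fun y : 'I_(2 * m) => y.+1) y); rewrite sy.
Qed.

Lemma prev_sourceP a :
  prev_source a = 0 \/
  exists2 y : 'I_(2 * m), is_source D y & prev_source a = y.+1.
Proof.
apply: (big_ind (fun v => v = 0 \/
  exists2 y : 'I_(2 * m), is_source D y & v = y.+1)) => [|p q Hp Hq|y /andP [sy _]].
- by left.
- by rewrite /maxn; case: ifP.
- by right; exists y.
Qed.

(** For [p < p'] one has [prev_source p <= p], while [p] is a source of [D] that takes part in the
    maximum defining [prev_source p']. *)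
Lemma prev_source_mono a b a' b' : sentinel_chord a b -> sentinel_chord a' b' ->
  (prev_source a < prev_source a') = (a < a').
Proof.
have half p q p' q' : sentinel_chord p q -> sentinel_chord p' q' -> p < p' ->
    prev_source p < prev_source p'.
  case/sentinel_chordP => [[c [hc -> _]]|[-> _]].
    move=> _ lt; apply: leq_ltn_trans (prev_source_le _) _.
    by apply: prev_source_gt; rewrite ?source1.
  by move=> /sentinel_chord_le; lia.
move=> h h'; apply/idP/idP; last exact: half h h'.
by case: (ltngtP a a') => // [/(half _ _ _ _ h' h)|->]; lia.
Qed.

Lemma prev_source_surj x : x <= 2 * m ->
  (forall y : 'I_(2 * m), y.+1 = x -> is_source D y) ->
  exists a b, sentinel_chord a b /\ prev_source a = x.
Proof.
move=> lx sx; pose P a := (x <= a) && [exists b : 'I_(2 * m).+1, sentinel_chord a b].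
have exP : exists a, P a.
  exists (2 * m); rewrite /P lx; apply/existsP; exists ord_max.
  by rewrite /sentinel_chord !eqxx orbT.
(* The least source of [D] or sentinel [a >= x] works: no source lies in [[x, a)], and [x - 1] is a
   source unless [x = 0]. *)
have [a /andP [lxa /existsP [b sab]] amin] := ex_minnP exP.
exists a, b; split=> //; apply/eqP; rewrite eqn_leq; apply/andP; split.
  apply/bigmax_leqP => y /andP [/exists_inP [c hc /eqP ey] lya].
  rewrite ltnNge; apply/negP => lxy; suff /amin : P y by lia.
  rewrite /P lxy; apply/existsP; exists (widen_ord (leqnSn _) c.2).
  by apply/orP; left; apply/exists_inP; exists c; rewrite // ey !eqxx.
case: x lx sx lxa {P exP amin} => // x lx sx lxa.
exact: (prev_source_gt (sx (Ordinal lx) erefl)).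
Qed.

Lemma prev_source_notin_sinks a b a' b' : sentinel_chord a b ->
  sentinel_chord a' b' -> prev_source a != b'.+1.
Proof.
move=> h h'; apply/eqP; case: (prev_sourceP a) => [->//|[y sy ->] [ey]].
case/sentinel_chordP: h' => [[c [hc _ eb]]|[_ eb]].
  have ec : y = c.2 by apply: val_inj; rewrite /= ey.
  by rewrite ec sink2 in sy.
by have := ltn_ord y; rewrite ey eb ltnn.
Qed.

Lemma lift_diagram : is_diagram lift_chords.
Proof.
apply/andP; split.
  apply/forall_inP => c /lift_chordsP [a [b [h -> ->]]].
  by have := sentinel_chord_le h; have := prev_source_le a; lia.
apply/forallP => x.
have [c hc cx] : exists2 c : chord m.+1, c \in lift_chords & endpoint c x.
  have mk a b : sentinel_chord a b -> prev_source a = x \/ b.+1 = x ->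
      exists2 c : chord m.+1, c \in lift_chords & endpoint c x.
    move=> h e; have le := sentinel_chord_le h; have lp := prev_source_le a.
    have l1 : prev_source a < 2 * m.+1 by lia.
    have l2 : b.+1 < 2 * m.+1 by lia.
    exists (Ordinal l1, Ordinal l2); first by apply/lift_chordsP; exists a, b.
    by rewrite /endpoint -!val_eqE /=; case: e => ->; rewrite eqxx ?orbT.
  case: (ltngtP x (2 * m).+1) => [lx|gx|ex]; first last.
  - by apply: (mk (2 * m) (2 * m)); [rewrite /sentinel_chord !eqxx orbT|right].
  - by have := ltn_ord x; lia.
  (* The test is vacuous at [x = 0], so that the new first position counts as a lifted source. *)
  case: (boolP [forall y : 'I_(2 * m), (y.+1 == x) ==> is_source D y]).
    move=> /forallP sx; have [||a [b [h e]]] := @prev_source_surj x.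
    - by rewrite -ltnS.
    - by move=> y /eqP ey; have := sx y; rewrite ey.
    by apply: mk h _; left.
  case/forallPn => y; rewrite negb_imply -source_or_sink => /andP [/eqP ey].
  case/exists_inP => c hc /eqP ec; apply: (mk c.1 c.2); last by right; rewrite ec.
  by apply/orP; left; apply/exists_inP; exists c; rewrite // !eqxx.
apply/cards1P; exists c; apply/setP => d; rewrite !inE.
apply/andP/eqP => [[hd dx]|-> //]; last first.
  by split => //; move: hc; rewrite inE.
have {hd} : d \in lift_chords by rewrite inE.
move: hc => /lift_chordsP [a [b [h e1 e2]]] /lift_chordsP [a' [b' [h' e1' e2']]].
(* Both coordinates increase together, so either one determines the chord. *)
have eqE : (a == a') = (b == b').
  have := sentinel_chord_lt h h'; have := sentinel_chord_lt h' h; lia.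
suff ea : a = a'.
  have eb : b = b' by apply/eqP; rewrite -eqE ea.
  case: c d e1 e2 e1' e2' {cx dx} => c1 c2 [d1 d2] /= e1 e2 e1' e2'.
  by congr (_, _); apply: val_inj; rewrite /= ?e1 ?e2 ?e1' ?e2' ?ea ?eb.
case/orP: cx => /eqP xc; case/orP: dx => /eqP xd.
- have : prev_source a = prev_source a' by rewrite -e1 -e1' -xc -xd.
  by have := prev_source_mono h h'; have := prev_source_mono h' h; lia.
- by have /eqP [] := prev_source_notin_sinks h h'; rewrite -e1 -e2' -xc -xd.
- by have /eqP [] := prev_source_notin_sinks h' h; rewrite -e1' -e2 -xc -xd.
- by apply/eqP; rewrite eqE; apply/eqP/succn_inj; rewrite -e2 -e2' -xc -xd.
Qed.

Definition lift : diagram m.+1 := exist _ lift_chords lift_diagram.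

Lemma lift_nonnesting : nonnesting lift.
Proof.
apply/forall_inP => c /lift_chordsP [a [b [h e1 e2]]].
apply/forall_inP => d /lift_chordsP [a' [b' [h' e1' e2']]].
rewrite /nested e1 e1' e2 e2' (prev_source_mono h h') ltnS (sentinel_chord_lt h h').
lia.
Qed.

Lemma lift_one_terminal : one_terminal lift.
Proof.
apply/forall_inP => c hc; apply/implyP => /forall_inP tc; rewrite /is_last hc /=.
apply/forall_inP => d hd; rewrite leqNgt; apply/negP => lt.
have /lift_chordsP [a [b [h e1 e2]]] := hc.
have /lift_chordsP [a' [b' [h' e1' e2']]] := hd.
have laa' : a < a' by rewrite -(prev_source_mono h h') -e1 -e1'.
case/sentinel_chordP: (h) => [[c' [hc' ea eb]]|[ea _]]; last first.
  by have := sentinel_chord_le h'; lia.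
have la : a < 2 * m by rewrite ea.
(* As [a] is a source of [D], position [a.+1] is a lifted source. Its chord is a right neighbor of
   [c], because [prev_source a < a.+1 < b.+1 < b2.+1]. *)
have [y [ey]|a2 [b2 [h2 e]]] := @prev_source_surj a.+1 la.
  have -> : y = c'.1 by apply: val_inj; rewrite /= ey.
  exact: source1 hc'.
have lt2 : a < a2 by rewrite -e prev_source_le.
have ltb : b < b2 by rewrite -(sentinel_chord_lt h h2).
have le2 := sentinel_chord_le h2.
have l1 : a.+1 < 2 * m.+1 by lia.
have l2 : b2.+1 < 2 * m.+1 by lia.
have := tc (Ordinal l1, Ordinal l2).
have -> : (Ordinal l1, Ordinal l2) \in chords lift.
  by apply/lift_chordsP; exists a2, b2; rewrite e.
move/(_ isT); rewrite /right_neighbor /= e1 e2 !ltnS (prev_source_le a) ltb.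
by rewrite ea eb (chord_lt hc').
Qed.

Lemma lift_source (x : 'I_(2 * m)) (y : 'I_(2 * m.+1)) :
  y = x.+1 :> nat -> is_source lift y = is_source D x.
Proof.
move=> yx; have [c hc] := chord_ex lift y.
have /lift_chordsP [a [b [h e1 e2]]] := hc.
case/orP => /eqP ey; rewrite ey.
  rewrite source1 //; move: yx; rewrite ey e1.
  by case: (prev_sourceP a) => [->//|[z sz ->] [/val_inj <-]].
rewrite sink2 //; move: yx; rewrite ey e2 => -[ebx].
case/sentinel_chordP: h => [[d [hd _ eb]]|[_ eb]].
  have -> : x = d.2 by apply: val_inj; rewrite /= -ebx.
  by rewrite sink2.
by have := ltn_ord x; rewrite -ebx eb ltnn.
Qed.

End Lift.

(** * Extreme positions and the bijection *)

Lemma source_eq0 n (T : diagram n) (x : 'I_(2 * n)) :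
  x = 0 :> nat -> is_source T x.
Proof.
move=> x0; have [c hc /orP [] /eqP e] := chord_ex T x; first by rewrite e source1.
by have := chord_lt hc; rewrite -e x0.
Qed.

Lemma source_max n (T : diagram n) (x : 'I_(2 * n)) :
  x.+1 = 2 * n -> is_source T x = false.
Proof.
move=> xn; have [c hc /orP [] /eqP e] := chord_ex T x; last by rewrite e sink2.
by have := chord_lt hc; have := ltn_ord c.2; rewrite -e; ord_lia.
Qed.

Theorem corollary8p14 (n : nat) (n_ge2 : 2 <= n) :
  (forall T : diagram n, connected T -> nonnesting T -> one_terminal T) /\
  (let A := [set T : one_terminal_diagram n |
              connected (val T) && nonnesting (val T)] in
   let B := [set D : diagram n.-1 | nonnesting D] in
   {in A &, injective (@psi n)} /\ [set psi T | T in A] = B).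
Proof.
split; first by move=> T cT nT; apply: connected_one_terminal.
split.
  move=> T T'; rewrite !inE => /andP [_ nT] /andP [_ nT'] e.
  apply: val_inj; apply: nonnesting_source_inj => // y.
  (* The first position is always a source and the last always a sink; [psi_source] recovers every
     other letter from the image. *)
  have [y0|y0] := posnP y; first by rewrite !source_eq0.
  case: (ltnP y.-1 (2 * n.-1)) => ly; last first.
    by have := ltn_ord y => ?; rewrite !source_max //; ord_lia.
  have yE : y = (Ordinal ly).+1 :> nat by rewrite /= prednK.
  by rewrite -!(psi_source _ yE) e.
apply/setP => D; rewrite inE; apply/imsetP/idP => [[T]|nD].
  by rewrite inE => /andP [_ nT] ->; apply: psi_nonnesting.
case: n n_ge2 D nD => // m _ D nD.
have nL := lift_nonnesting nD; have oL := lift_one_terminal nD.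
exists (exist _ (lift nD) oL : one_terminal_diagram m.+1).
  by rewrite inE /= nL one_terminal_connected.
(* Both diagrams are nonnesting, so it suffices to compare sources: [psi_source] and [lift_source]
   apply the same shift by one. *)
apply: nonnesting_source_inj => //; first exact: psi_nonnesting.
move=> x; have lx : x.+1 < 2 * m.+1 by have := ltn_ord x; ord_lia.
have yx : Ordinal lx = x.+1 :> nat by [].
by rewrite (psi_source _ yx) /= (lift_source nD yx).
Qed.
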